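(* Assume $x(0)=x'(0)=0$. Suppose that $y_2(t)=o(1/A(t))$ as $t\to\infty$ and $\int_0^\infty A(s)|y_2(s)|\,ds<\infty$. Then there exist constants $c_1,c_2$ such that \[ x(t)=\frac{c_1\sin(\omega t)+c_2\cos(\omega t)}{A(t)}+o\Big(\frac{1}{A(t)}\Big)\quad(t\to\infty). \]
   Context: Standing assumptions: $\omega>0$ is a constant; $p\in C^1([0,\infty))$ with $p(t)>0$ and $p'(t)<0$ for all $t\ge0$, $\int_0^\infty p(t)\,dt=\infty$ and $\int_0^\infty p(t)^2\,dt<\infty$; $f\in L^1_{\mathrm{loc}}([0,\infty))$. $x$ denotes the solution of $x''(t)+p(t)x'(t)+\omega^2x(t)=f(t)$, $t\ge0$. Notation: $A(t)=\exp(\frac12\int_0^tp(s)\,ds)$; $y_1(t)=\int_0^te^{-\omega^2(t-s)}f(s)\,ds$; $y_2(t)=\int_0^te^{-\omega^2(t-s)}y_1(s)\,ds=\int_0^t(t-s)e^{-\omega^2(t-s)}f(s)\,ds$. *)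

(* Defs.v *)
From HB Require Import structures.
From mathcomp Require Import all_boot all_order all_algebra.
From mathcomp Require Import all_classical all_reals all_analysis.
Set Implicit Arguments. Unset Strict Implicit. Unset Printing Implicit Defensive.
Import Order.TTheory GRing.Theory Num.Theory.
Import numFieldNormedType.Exports.
Local Open Scope classical_set_scope.
Local Open Scope ring_scope.

Section Defs.
Variable R : realType.
Notation mu := (@lebesgue_measure R).

Definition Afun (p : R -> R) (t : R) : R :=
  expR (2^-1 * Rintegral mu `[0, t] p).

Definition y1fun (w : R) (f : R -> R) (t : R) : R :=
  Rintegral mu `[0, t] (fun s => expR (- (w ^+ 2 * (t - s))) * f s).

Definition y2fun (w : R) (f : R -> R) (t : R) : R :=
  Rintegral mu `[0, t] (fun s => expR (- (w ^+ 2 * (t - s))) * y1fun w f s).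

(* x is a (Caratheodory) solution on [0,oo) of x'' + p x' + w^2 x = f :
   x is C^1 on [0,oo) and x'(t) = x'(0) + int_0^t (f - p x' - w^2 x). *)
Definition is_solution (p f : R -> R) (w : R) (x : R -> R) : Prop :=
  (forall t, 0 <= t -> derivable x t 1) /\
  {within `[0, +oo[, continuous derive1 x} /\
  (forall t, 0 <= t ->
     derive1 x t = derive1 x 0 +
       Rintegral mu `[0, t] (fun s => f s - p s * derive1 x s - w ^+ 2 * x s)).
Definition halfline : set R := `[0, +oo[.
End Defs.

(* Main.v *)
Require Import Defs.
From HB Require Import structures.
From mathcomp Require Import all_boot all_order all_algebra.
From mathcomp Require Import all_classical all_reals all_analysis.
From mathcomp Require Import measurable_realfun ring lra.
Import Order.TTheory GRing.Theory Num.Theory.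
Import numFieldNormedType.Exports.
Local Open Scope classical_set_scope.
Local Open Scope ring_scope.

(* The primitive of f enters x' and y2' in the same way and cancels from their
   difference, so z = x - y2 is of class C^2 on (0, oo) although f is merely
   integrable.  With c = w^2 and v = A z, put
   r = v' - g where g = A (2 c - p) y2; then
     v' = r + g,   r' = - w^2 v + q v + h,
   with q = p'/2 + p^2/4 and
   h = A y2 (c^2 - c - c p + p^2/2 + p').  Subtracting g from v' removes y1, so
   that only y2 is left.  Since p' <= 0 and A y2 is eventually at most 1 in
   absolute value, |g|, |q| and |h| are eventually dominated by a multiple of
   - p' + p^2 + A |y2|, which is integrable.  Thus (v, r) solves an integrable
   perturbation of the harmonic oscillator: its energy is bounded by Gronwall,
   and (w v, r) rotated by the angle w t converges. *)

(** * Differentiation rules in pointwise form and convergence at infinity *)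

Section PointwiseDerivatives.
Set Implicit Arguments.
Unset Strict Implicit.
Context {R : realType}.
Implicit Types (f g : R -> R) (t a b c : R).

Lemma is_derive_add f g t a b : is_derive t 1 f a -> is_derive t 1 g b ->
  is_derive t 1 (fun s => f s + g s) (a + b).
Proof. exact: is_deriveD. Qed.

Lemma is_derive_sub f g t a b : is_derive t 1 f a -> is_derive t 1 g b ->
  is_derive t 1 (fun s => f s - g s) (a - b).
Proof. exact: is_deriveB. Qed.

Lemma is_derive_opp f t a : is_derive t 1 f a ->
  is_derive t 1 (fun s => - f s) (- a).
Proof. exact: is_deriveN. Qed.

Lemma is_derive_mul f g t a b : is_derive t 1 f a -> is_derive t 1 g b ->
  is_derive t 1 (fun s => f s * g s) (a * g t + f t * b).
Proof.
move=> df dg; apply: (is_derive_eq (is_deriveM df dg)).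
by rewrite addrC [g t *: a]mulrC.
Qed.

Lemma is_derive_scale f t a c : is_derive t 1 f a ->
  is_derive t 1 (fun s => c * f s) (c * a).
Proof. exact: is_deriveZ. Qed.

Lemma is_derive_const t c : is_derive t 1 (fun _ : R => c) 0.
Proof. exact: is_derive_cst. Qed.

Lemma is_derive_expcomp f t a : is_derive t 1 f a ->
  is_derive t 1 (fun s => expR (f s)) (expR (f t) * a).
Proof. by move=> df; apply: is_derive1_comp. Qed.

Lemma is_derive_linear t c : is_derive t 1 (fun s => c * s) c.
Proof.
by have := is_derive_scale c (is_derive_id _ _); rewrite mulr1.
Qed.

Lemma is_derive_sinM t c : is_derive t 1 (fun s => sin (c * s)) (cos (c * t) * c).
Proof. by apply: is_derive1_comp; exact: is_derive_linear. Qed.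

Lemma is_derive_cosM t c : is_derive t 1 (fun s => cos (c * s)) (- sin (c * t) * c).
Proof. by apply: is_derive1_comp; exact: is_derive_linear. Qed.

Lemma nondecreasing_of_derive {f} {df : R -> R} {a} :
  (forall t, a <= t -> is_derive t 1 f (df t)) ->
  (forall t, a <= t -> 0 <= df t) ->
  forall s t, a <= s -> s <= t -> f s <= f t.
Proof.
move=> dfE df0; apply: ger0_derive1_ndecry.
- move=> x; rewrite in_itv/= andbT => /ltW ax.
  by have [] := dfE _ ax.
- move=> x; rewrite in_itv/= andbT => /ltW ax.
  by rewrite derive1E; have [_ ->] := dfE _ ax; exact: df0.
- apply: derivable_within_continuous => x; rewrite in_itv/= andbT => ax.
  by have [] := dfE _ ax.
Qed.

Lemma nondecreasing_bounded_cvgy {f} {a M : R} :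
  (forall s t, a <= s -> s <= t -> f s <= f t) ->
  (forall t, a <= t -> f t <= M) ->
  exists l : R, f t @[t --> +oo] --> l.
Proof.
(* Freezing [f] at the value [f a] to the left of [a] gives a function that is monotone on the whole
   line and agrees with [f] near infinity. *)
move=> fnd fM; pose g t := f (Num.max a t).
exists (sup (range g)); apply: cvg_trans (nondecreasing_cvgr (f := g) _ _).
- apply: near_eq_cvg; near=> t; rewrite /g max_r; first by [].
  by near: t; exact: nbhs_pinfty_ge (num_real a).
- move=> s t st; apply: fnd; first by rewrite le_max lexx.
  by rewrite ge_max !le_max lexx st/= orbT.
- by exists M => _ [t _ <-]; apply: fM; rewrite le_max lexx.
Unshelve. all: by end_near. Qed.

(* [f + C Phi] is nondecreasing and bounded, and so is [Phi]. *)
Lemma cvgy_of_derive_le {f} {df Phi psi : R -> R} {a M C B : R} : 0 <= C ->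
  (forall t, a <= t -> is_derive t 1 f (df t)) ->
  (forall t, a <= t -> is_derive t 1 Phi (psi t)) ->
  (forall t, a <= t -> 0 <= psi t) ->
  (forall t, a <= t -> Phi t <= M) ->
  (forall t, a <= t -> f t <= B) ->
  (forall t, a <= t -> `|df t| <= C * psi t) ->
  exists l : R, f t @[t --> +oo] --> l.
Proof.
move=> C0 dfE dPhi psi0 PhiM fB dfpsi.
have [l1 Phil] := nondecreasing_bounded_cvgy (nondecreasing_of_derive dPhi psi0) PhiM.
have [l2 fl] : exists l : R, f t + C * Phi t @[t --> +oo] --> l.
  apply: (@nondecreasing_bounded_cvgy _ a (B + C * M)).
    apply: (nondecreasing_of_derive
      (fun t at_ => is_derive_add (dfE t at_) (is_derive_scale C (dPhi t at_)))).
    by move=> t at_; have := dfpsi t at_; rewrite ler_norml => /andP[]; lra.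
  by move=> t at_; rewrite lerD ?fB// ler_wpM2l ?PhiM.
exists (l2 - C * l1).
rewrite (_ : f = fun t => (f t + C * Phi t) - C * Phi t).
  by apply: cvgB => //; apply: cvgMr.
by apply/funext => t; rewrite addrK.
Qed.

End PointwiseDerivatives.

(** * Integrable perturbations of the harmonic oscillator *)

Section PerturbedOscillator.
Set Implicit Arguments.
Unset Strict Implicit.
Context {R : realType}.
Variables (w K M a : R) (v r g q h Phi psi : R -> R).
Hypothesis w_gt0 : 0 < w.
Hypothesis dv : forall t, a <= t -> is_derive t 1 v (r t + g t).
Hypothesis dr : forall t, a <= t ->
  is_derive t 1 r (- w ^+ 2 * v t + q t * v t + h t).
(** Integrability of the majorant [psi] is encoded by a primitive [Phi] that is bounded above, so no
    integral occurs in this section. *)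
Hypothesis dPhi : forall t, a <= t -> is_derive t 1 Phi (psi t).
Hypothesis PhiM : forall t, a <= t -> Phi t <= M.
Hypothesis gpsi : forall t, a <= t -> `|g t| <= K * psi t.
Hypothesis qpsi : forall t, a <= t -> `|q t| <= K * psi t.
Hypothesis hpsi : forall t, a <= t -> `|h t| <= K * psi t.
Hypothesis K_gt0 : 0 < K.

Let psi_ge0 t : a <= t -> 0 <= psi t.
Proof. by move=> /gpsi /(le_trans (normr_ge0 _)); rewrite pmulr_rge0. Qed.

(* Gronwall for the energy [E = w^2 v^2 + r^2]: [(1 + E) exp (- L Phi)] is
   nonincreasing. *)
Lemma oscillator_energy_bounded :
  exists B : R, forall t, a <= t -> w ^+ 2 * v t ^+ 2 + r t ^+ 2 <= B.
Proof.
(* The summands [w], [w^-1] and [1] are the costs of [g], [q] and [h] in the estimate of the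
   derivative of the energy. *)
pose L := K * (w + w^-1 + 1).
have L0 : 0 < L by rewrite mulr_gt0// !addr_gt0 ?invr_gt0.
pose E t := w ^+ 2 * (v t * v t) + r t * r t.
(* The [1] added to [E] absorbs the inhomogeneous terms [g] and [h]; the sign makes [N]
   nondecreasing. *)
pose N t := - ((1 + E t) * expR (- L * Phi t)).
pose dE t := w ^+ 2 * ((r t + g t) * v t + v t * (r t + g t)) +
  ((- w ^+ 2 * v t + q t * v t + h t) * r t +
    r t * (- w ^+ 2 * v t + q t * v t + h t)).
have dEE t : a <= t -> is_derive t 1 E (dE t).
  move=> at_.
  have dv2 := is_derive_scale (w ^+ 2) (is_derive_mul (dv at_) (dv at_)).
  exact: is_derive_add dv2 (is_derive_mul (dr at_) (dr at_)).
have dEle t : a <= t -> dE t <= L * psi t * (1 + E t).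
  move=> at_; have p0 := psi_ge0 at_.
  have gp := gpsi at_; have qp := qpsi at_; have hp := hpsi at_.
  (* The unperturbed oscillator conserves energy: the terms in [r t * v t] without a perturbation
     factor cancel. *)
  have -> : dE t = 2 * (w ^+ 2 * (v t * g t)) + 2 * (r t * v t * q t)
      + 2 * (r t * h t) by rewrite /dE; ring.
  have young (x y z m : R) : `|z| <= m -> 0 <= m -> 2 * (x * y * z) <= m * (x ^+ 2 + y ^+ 2).
    move=> zm m0; apply: (@le_trans _ _ (2 * (`|x| * `|y|) * m)).
      rewrite -[leRHS]mulrA ler_pM2l ?ltr0n//; apply: le_trans (ler_norm (x * y * z)) _.
      by rewrite !normrM ler_wpM2l// mulr_ge0.
    rewrite mulrC ler_wpM2l// -(real_normK (num_real x)) -(real_normK (num_real y)).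
    by have := sqr_ge0 (`|x| - `|y|); lra.
  have m0 : 0 <= K * psi t by rewrite mulr_ge0// ltW.
  have g1 := young (w * v t) 1 _ _ gp m0.
  have q1 := young (w * v t) (r t) _ _ qp m0.
  have h1 := young (r t) 1 _ _ hp m0.
  set m := K * psi t in g1 q1 h1 m0.
  have e1 : 2 * (w ^+ 2 * (v t * g t)) <= w * (m * ((w * v t) ^+ 2 + 1)).
    have -> : 2 * (w ^+ 2 * (v t * g t)) = w * (2 * (w * v t * 1 * g t)) by ring.
    by rewrite ler_pM2l//; rewrite expr1n in g1.
  have e2 : 2 * (r t * v t * q t) <= w^-1 * (m * ((w * v t) ^+ 2 + r t ^+ 2)).
    have -> : 2 * (r t * v t * q t) = w^-1 * (2 * (w * v t * r t * q t)).
      by field; rewrite gt_eqF.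
    by rewrite ler_pM2l// invr_gt0.
  have -> : L * psi t * (1 + E t) = w * (m * (1 + E t)) +
     w^-1 * (m * (1 + E t)) + m * (1 + E t) by rewrite /L /m; ring.
  have wi : 0 < w^-1 by rewrite invr_gt0.
  apply: lerD; first apply: lerD.
  - apply: le_trans e1 _; rewrite ler_pM2l// ler_wpM2l// /E.
    by have := sqr_ge0 (r t); lra.
  - by apply: le_trans e2 _; rewrite ler_pM2l// ler_wpM2l// /E; lra.
  - have -> : 2 * (r t * h t) = 2 * (r t * 1 * h t) by ring.
    apply: le_trans h1 _; rewrite ler_wpM2l// /E.
    by have := sqr_ge0 (w * v t); lra.
have dN t : a <= t -> is_derive t 1 N
    (- ((0 + dE t) * expR (- L * Phi t) +
       (1 + E t) * (expR (- L * Phi t) * (- L * psi t)))).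
  move=> at_; apply: is_deriveN; apply: is_derive_mul.
    by apply: is_derive_add (dEE _ at_); exact: is_derive_const.
  by apply: is_derive_expcomp; apply: is_derive_scale; exact: dPhi.
have Nnd := nondecreasing_of_derive dN.
exists ((1 + E a) * expR (- L * Phi a) * expR (L * M)) => t at_.
have /Nnd/(_ a t (lexx a) at_) : forall t, a <= t -> 0 <=
    - ((0 + dE t) * expR (- L * Phi t) +
       (1 + E t) * (expR (- L * Phi t) * (- L * psi t))).
  move=> s as_; rewrite (_ : - _ =
    (L * psi s * (1 + E s) - dE s) * expR (- L * Phi s)); last by ring.
  by rewrite mulr_ge0 ?expR_ge0// subr_ge0 dEle.
rewrite /N lerN2 => le1.
apply: (@le_trans _ _ (1 + E t)); first by rewrite /E; lra.
have E0 : 0 <= 1 + E t.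
  by rewrite /E; have := sqr_ge0 (r t); have := sqr_ge0 (w * v t); lra.
apply: (@le_trans _ _ ((1 + E t) * expR (- L * Phi t) * expR (L * M))).
  rewrite -mulrA ler_peMr// -expRD -expR0 ler_expR.
  by rewrite mulNr addrC subr_ge0 ler_pM2l// PhiM.
by rewrite ler_wpM2r// expR_ge0.
Qed.

(* Rotating [(w v, r)] by the angle [w t] leaves an integrable derivative. *)
Lemma oscillator_asymptotics : exists c1 c2 : R,
  (v t - (c1 * sin (w * t) + c2 * cos (w * t))) @[t --> +oo] --> 0.
Proof.
have [B0 EB0] := oscillator_energy_bounded.
(* Since [|u| <= 1 + u ^+ 2], the added [1] turns the bound on the squares into a bound on
   [|w * v t|] and [|r t|] themselves. *)
pose B := 1 + B0.
have B1 : 1 <= B.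
  rewrite lerDl; apply: le_trans (EB0 a (lexx _)).
  by rewrite -exprMn addr_ge0 ?sqr_ge0.
have EB t : a <= t -> `|w * v t| <= B /\ `|r t| <= B.
  move=> at_; have := EB0 t at_.
  rewrite -exprMn -(real_normK (num_real (w * _))) -(real_normK (num_real (r t))).
  have := sqr_ge0 (`|w * v t| - 1); have := sqr_ge0 (`|r t| - 1).
  have := sqr_ge0 (`|w * v t|); have := sqr_ge0 (`|r t|).
  by have := normr_ge0 (w * v t); have := normr_ge0 (r t); rewrite /B; split; nra.
(* [B / w] bounds [|v t|], so [C * psi t] dominates [w * |g t| + |q t * v t + h t|]. *)
pose C := K * (w + B / w + 1).
have C0 : 0 <= C.
  by rewrite mulr_ge0 ?ltW// !addr_gt0// divr_gt0// (lt_le_trans _ B1).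
pose P t := q t * v t + h t.
have Ppsi t : a <= t -> w * `|g t| + `|P t| <= C * psi t.
  move=> at_; have [vB _] := EB t at_.
  have -> : C * psi t = w * (K * psi t) + (K * psi t * (B / w) + K * psi t).
    by rewrite /C; ring.
  apply: lerD; first by rewrite ler_pM2l// gpsi.
  apply: le_trans (ler_normD _ _) _; apply: lerD; last exact: hpsi.
  rewrite normrM ler_pM// ?qpsi// ler_pdivlMr// mulrC.
  by move: vB; rewrite normrM gtr0_norm.
have lip (s c : R) t : `|s| <= 1 -> `|c| <= 1 -> a <= t ->
    `|w * g t * s + P t * c| <= C * psi t.
  move=> s1 c1 at_; apply: le_trans (Ppsi t at_).
  apply: le_trans (ler_normD _ _) _; rewrite !normrM (gtr0_norm w_gt0).
  by apply: lerD; rewrite ler_piMr// mulr_ge0// ltW.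
have bnd (s c : R) t : `|s| <= 1 -> `|c| <= 1 -> a <= t ->
    w * v t * s + r t * c <= B + B.
  move=> s1 c1 at_; have [vB rB] := EB t at_.
  apply: le_trans (ler_norm _) _; apply: le_trans (ler_normD _ _) _.
  by apply: lerD; rewrite normrM -[leRHS]mulr1 ler_pM.
(* In the rotated coordinates [al] and [be] the oscillator terms cancel, and only [g] and [P] remain
   in the derivatives. Writing [+ r t * - sin] in [be] lets [bnd] and [lip] serve both. *)
pose al t := w * v t * sin (w * t) + r t * cos (w * t).
pose be t := w * v t * cos (w * t) + r t * - sin (w * t).
have [l1 all1] : exists l : R, al t @[t --> +oo] --> l.
  apply: (@cvgy_of_derive_le _ _ (fun t => w * g t * sin (w * t) +
      P t * cos (w * t)) Phi psi a M C (B + B)) => //.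
  - move=> t at_; apply: is_derive_eq; first apply: is_derive_add.
    + exact: is_derive_mul (is_derive_scale w (dv at_)) (is_derive_sinM t w).
    + exact: is_derive_mul (dr at_) (is_derive_cosM t w).
    + by rewrite /P; ring.
  - by move=> t at_; apply: bnd => //; [exact: sin_max|exact: cos_max].
  - by move=> t at_; apply: lip => //; [exact: sin_max|exact: cos_max].
have [l2 bel2] : exists l : R, be t @[t --> +oo] --> l.
  apply: (@cvgy_of_derive_le _ _ (fun t => w * g t * cos (w * t) +
      P t * - sin (w * t)) Phi psi a M C (B + B)) => //.
  - move=> t at_; apply: is_derive_eq; first apply: is_derive_add.
    + exact: is_derive_mul (is_derive_scale w (dv at_)) (is_derive_cosM t w).
    + exact: is_derive_mul (dr at_) (is_derive_opp (is_derive_sinM t w)).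
    + by rewrite /P; ring.
  - by move=> t at_; apply: bnd => //; [exact: cos_max|rewrite normrN; exact: sin_max].
  - by move=> t at_; apply: lip => //; [exact: cos_max|rewrite normrN; exact: sin_max].
(* Rotating back gives [w * v t = al t * sin (w * t) + be t * cos (w * t)]. *)
exists (l1 / w), (l2 / w).
have wn0 : w != 0 by rewrite gt_eqF.
rewrite (_ : (fun t => _) = fun t => w^-1 * ((al t - l1) * sin (w * t)
   + (be t - l2) * cos (w * t))); last first.
  apply/funext => t; rewrite /al /be.
  rewrite -[in LHS](mulr1 (v t)) -(cos2Dsin2 (w * t)).
  by field.
have cvg0 (u s : R -> R) (l : R) : u t @[t --> +oo] --> l ->
    (forall t, `|s t| <= 1) -> (u t - l) * s t @[t --> +oo] --> 0.
  move=> ul s1; apply/cvgr0Pnorm_le => e e0; near=> t.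
  rewrite normrM -[leRHS]mulr1 ler_pM// distrC.
  by near: t; move/cvgrPdist_le : ul; exact.
rewrite -(mulr0 w^-1) -(addr0 0); apply: cvgMr; apply: cvgD.
  by apply: cvg0 => // t; exact: sin_max.
by apply: cvg0 => // t; exact: cos_max.
Unshelve. all: by end_near. Qed.

End PerturbedOscillator.

(** * Primitives and exponential convolutions on the half-line *)

Section ExponentialConvolution.
Set Implicit Arguments.
Unset Strict Implicit.
Context {R : realType}.
Notation mu := (@lebesgue_measure R).
Implicit Types (f h : R -> R) (a b c s t T : R).

(** Negative [T] give an empty segment, so quantifying over all [T] avoids sign conditions at no
    cost. *)
Definition locint f := forall T, mu.-integrable `[0, T] (EFin \o f).

Definition cont0 h := {within `[0, +oo[, continuous h}.

Definition prim f t := \int[mu]_(s in `[0, t]) f s.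

(** With [c = w ^+ 2], one application to [f] gives [y1fun] and a second one gives [y2fun]. *)
Definition expconv c f t := \int[mu]_(s in `[0, t]) (expR (- (c * (t - s))) * f s).

Lemma cont0_segment h T : cont0 h -> {within `[0, T], continuous h}.
Proof. by apply: continuous_subspaceW => s /=; rewrite !in_itv/= => /andP[->]. Qed.

Lemma cont0_of_segment h : (forall T, 0 < T -> {within `[0, T], continuous h}) ->
  cont0 h.
Proof.
move=> hT; apply/continuous_within_itvcyP; split.
  move=> t; rewrite in_itv/= andbT => t0.
  have t1 : 0 < t + 1 by rewrite addr_gt0.
  apply: (within_continuous_continuous t1 (hT _ t1)).
  by rewrite in_itv/= t0 ltrDl ltr01.
by have /(continuous_within_itvP _ ltr01)[_ ] := hT 1 ltr01.
Qed.

Lemma cont0_at h t : cont0 h -> 0 < t -> {for t, continuous h}.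
Proof.
by move=> /continuous_within_itvcyP[hc _] t0; apply: hc; rewrite in_itv/= t0.
Qed.

Lemma cont0_locint h : cont0 h -> locint h.
Proof.
move=> hc T; apply: continuous_compact_integrable; first exact: segment_compact.
exact: cont0_segment.
Qed.

Lemma cont0_derivable h : (forall t, 0 <= t -> derivable h t 1) -> cont0 h.
Proof.
move=> dh; apply: derivable_within_continuous => t.
by rewrite in_itv/= andbT; exact: dh.
Qed.

Lemma cont0D f h : cont0 f -> cont0 h -> cont0 (fun t => f t + h t).
Proof. by move=> cf ch t; apply: cvgD; [exact: cf|exact: ch]. Qed.

Lemma cont0M f h : cont0 f -> cont0 h -> cont0 (fun t => f t * h t).
Proof. by move=> cf ch t; apply: cvgM; [exact: cf|exact: ch]. Qed.

Lemma cont0_norm f : cont0 f -> cont0 (fun t => `|f t|).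
Proof. by move=> cf t; apply: cvg_norm; exact: cf. Qed.

Lemma cont0_cst c : cont0 (fun=> c).
Proof. by move=> t; exact: cvg_cst. Qed.

Lemma cont0_exp f : cont0 f -> cont0 (fun t => expR (f t)).
Proof. by move=> cf t; apply: continuous_comp; [exact: cf|exact: continuous_expR]. Qed.

Lemma cont0_lin c : cont0 (fun t => c * t).
Proof.
apply: cont0_derivable => t _.
by have [] := is_derive_linear t c.
Qed.

Lemma prim_cont f : locint f -> cont0 (prim f).
Proof.
move=> fi; apply: cont0_of_segment => T T0.
exact: parameterized_integral_continuous (ltW T0) (fi T).
Qed.

Lemma prim_derive h t : cont0 h -> 0 < t -> is_derive t 1 (prim h) (h t).
Proof.
move=> hc t0.
have t1 : t < t + 1 by rewrite ltrDl.
have [dh hE] := continuous_FTC1_closed t1 (cont0_locint hc (t + 1)) t0 (cont0_at hc t0).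
by split => //; rewrite -derive1E.
Qed.

Lemma locint_mul f h : cont0 h -> locint f -> locint (fun t => h t * f t).
Proof.
move=> hc fi T; have ch := @cont0_segment h T hc.
apply: (integrableMr (mu := mu)) (fi T) => //.
  exact: subspace_continuous_measurable_fun.
have /compact_bounded[M [Mr Mh]] :=
  continuous_compact ch (@segment_compact _ 0 T).
by exists M; split => // x /Mh xM s sT; apply: xM; exists s.
Qed.

Lemma locint_norm f : locint f -> locint (fun t => `|f t|).
Proof. by move=> fi T; exact: integrable_norm (fi T). Qed.

(** Splitting the exponential moves [t] out of the integrand, so continuity and derivatives reduce
    to those of a primitive. *)
Lemma expconvE c f : locint f ->
  expconv c f = fun t => expR (- c * t) * prim (fun s => expR (c * s) * f s) t.
Proof.
move=> fi; apply/funext => t; rewrite /prim -RintegralZl//; last first.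
  by apply: locint_mul => //; apply/cont0_exp/cont0_lin.
apply: eq_Rintegral => s _; rewrite mulrA -expRD; congr (expR _ * _); ring.
Qed.

Lemma expconv_cont c f : locint f -> cont0 (expconv c f).
Proof.
move=> fi; rewrite expconvE//; apply: cont0M.
  by apply/cont0_exp/cont0_lin.
by apply/prim_cont/locint_mul => //; apply/cont0_exp/cont0_lin.
Qed.

Lemma expconv_derive c h t : cont0 h -> 0 < t ->
  is_derive t 1 (expconv c h) (h t - c * expconv c h t).
Proof.
move=> hc t0; have he : cont0 (fun s => expR (c * s) * h s).
  by apply: cont0M => //; apply/cont0_exp/cont0_lin.
rewrite expconvE; last exact: cont0_locint.
have de := is_derive_expcomp (is_derive_linear t (- c)).
apply: (is_derive_eq (is_derive_mul de (prim_derive he t0))).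
rewrite /= mulrA -expRD mulNr addNr expR0; ring.
Qed.

Lemma prim_segment f a b : locint f -> 0 <= a -> a <= b ->
  prim f b - prim f a = \int[mu]_(s in `]a, b]) f s.
Proof. by move=> fi a0 ab; apply: Rintegral_itvB => //; rewrite bnd_simp. Qed.

Lemma segment_integrable f a b : locint f -> 0 <= a ->
  mu.-integrable `]a, b] (EFin \o f).
Proof.
move=> fi a0; apply: integrableS (fi b) => // s /=; rewrite !in_itv/=.
by move=> /andP[/ltW /(le_trans a0) -> ->].
Qed.

Lemma normr_prim_segment f a b : locint f -> 0 <= a -> a <= b ->
  `|prim f b - prim f a| <= prim (fun s => `|f s|) b - prim (fun s => `|f s|) a.
Proof.
move=> fi a0 ab; rewrite !prim_segment//; last exact: locint_norm.
by apply: le_normr_Rintegral => //; exact: segment_integrable.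
Qed.

(** Cut [[0, T]] into [n + 1] equal pieces. The increments of [N] telescope, so [|k T - k 0|] is at
    most [C * T * (N T - N 0) / (n + 1)] for every [n]. *)
Lemma constant_of_increment_le (k N : R -> R) C T : 0 <= T ->
  (forall a b, 0 <= a -> a <= b -> b <= T ->
    `|k b - k a| <= C * (b - a) * (N b - N a)) ->
  k T = k 0.
Proof.
move=> T0 kN; apply/eqP; rewrite -subr_eq0 -normr_le0.
have step n (i : nat) : (i <= n.+1)%N -> `|k (i%:R * (T / n.+1%:R)) - k 0| <=
    C * (T / n.+1%:R) * (N (i%:R * (T / n.+1%:R)) - N 0).
  set d := T / _; have d0 : 0 <= d by rewrite divr_ge0.
  elim: i => [|i IH] ilen; first by rewrite mul0r !subrr normr0 mulr0.
  rewrite -[X in `|X|](subrKA (k (i%:R * d))).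
  apply: le_trans (ler_normD _ _) _.
  have -> : C * d * (N (i.+1%:R * d) - N 0) =
      C * d * (N (i.+1%:R * d) - N (i%:R * d)) + C * d * (N (i%:R * d) - N 0).
    by ring.
  apply: lerD.
    have := kN (i%:R * d) (i.+1%:R * d).
    have -> : i.+1%:R * d - i%:R * d = d by rewrite -mulrBl -natr1 addrAC subrr add0r mul1r.
    apply; first by rewrite mulr_ge0.
    - by rewrite ler_wpM2r// ler_nat.
    - by rewrite /d mulrCA ler_piMr// ler_pdivrMr ?ltr0n// mul1r ler_nat.
  by apply: IH; exact: ltnW.
pose D := C * T * (N T - N 0).
have kD n : `|k T - k 0| * n.+1%:R <= D.
  have := step n n.+1 (leqnn _).
  have -> : n.+1%:R * (T / n.+1%:R) = T by rewrite mulrC divfK// pnatr_eq0.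
  move=> le1; rewrite -ler_pdivlMr ?ltr0n//; apply: le_trans le1 _.
  by rewrite /D le_eqVlt; apply/orP; left; apply/eqP; ring.
rewrite leNgt; apply/negP => k0.
have /archi_boundP : 0 <= D / `|k T - k 0|.
  by rewrite divr_ge0 ?normr_ge0//; apply: le_trans _ (kD 0%N); rewrite mulr1.
rewrite ltNge => /negP; apply; rewrite ler_pdivlMr// mulrC.
apply: le_trans _ (kD (Num.bound (D / `|k T - k 0|))).
by rewrite ler_wpM2l// ler_nat.
Qed.

(** Mean value theorem, with [|c| * expR (|c| * T)] bounding the derivative on [[0, T]]. *)
Lemma expR_lipschitz c T : exists L : R, 0 <= L /\
  forall a b, 0 <= a -> a <= b -> b <= T ->
    `|c * expR (c * a)| <= L /\ `|expR (c * b) - expR (c * a)| <= L * (b - a).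
Proof.
pose L := `|c| * expR (`|c| * T).
have cL a : 0 <= a -> a <= T -> `|c * expR (c * a)| <= L.
  move=> a0 aT; rewrite normrM ler_wpM2l// ger0_norm ?expR_ge0// ler_expR.
  apply: le_trans (ler_norm _) _; rewrite normrM (ger0_norm a0).
  by rewrite ler_wpM2l.
exists L; split; first by rewrite mulr_ge0 ?expR_ge0.
move=> a b a0 ab bT; split; first by rewrite cL// (le_trans ab).
have dexp s : is_derive s 1 (fun s => expR (c * s)) (expR (c * s) * c).
  exact: is_derive_expcomp (is_derive_linear s c).
have [//|s sab ->] := @MVT_segment _ (fun s => expR (c * s))
   (fun s => expR (c * s) * c) a b ab (fun s _ => dexp s).
  by apply: derivable_within_continuous => s _; have [] := dexp s.
rewrite normrM [X in _ * X]ger0_norm ?subr_ge0// ler_wpM2r ?subr_ge0//.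
move: sab; rewrite in_itv/= => /andP[as_ sb].
by rewrite mulrC cL// ?(le_trans a0)// (le_trans sb).
Qed.

(** The factor [1] keeps the integrand in the shape [c * expR (c * s) * h s] used in the integration
    by parts. *)
Lemma prim_cexp c T : 0 <= T ->
  prim (fun s => c * expR (c * s) * 1) T = expR (c * T) - 1.
Proof.
rewrite le_eqVlt => /predU1P[<-|T0].
  by rewrite /prim set_itv1 Rintegral_set1 mulr0 expR0 subrr.
have dexp s : is_derive s 1 (fun s => expR (c * s)) (expR (c * s) * c).
  exact: is_derive_expcomp (is_derive_linear s c).
have cexp : continuous (fun s => expR (c * s)).
  move=> s; apply: differentiable_continuous; apply/derivable1_diffP.
  by have [] := dexp s.
rewrite /prim /Rintegral (@continuous_FTC2 _ _ (fun s => expR (c * s))) //=.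
- by rewrite mulr0 expR0.
- by apply: continuous_subspaceT => s; do 2 (apply: cvgM; last exact: cvg_cst || exact: cexp); exact: cvg_cst.
- split.
  + by move=> s _; have [] := dexp s.
  + exact/cvg_at_right_filter/cexp.
  + exact/cvg_at_left_filter/cexp.
- by move=> s _; rewrite derive1E; have [_ ->] := dexp s; rewrite mulr1 mulrC.
Qed.

(* Integration by parts for a merely integrable [f]: the defect [k] satisfies
   [|k b - k a| <= C (b - a) (N b - N a)] with [N] the primitive of [|f|]. *)
Lemma prim_expM c f T : locint f -> 0 <= T ->
  prim (fun s => expR (c * s) * f s) T =
  expR (c * T) * prim f T - c * prim (fun s => expR (c * s) * prim f s) T.
Proof.
move=> fi T0.
pose F := prim f; pose N := prim (fun s => `|f s|).
pose k t := prim (fun s => expR (c * s) * f s) t - expR (c * t) * F t +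
   c * prim (fun s => expR (c * s) * F s) t.
have prim0 h : prim h 0 = 0 by rewrite /prim set_itv1 Rintegral_set1.
have ec : cont0 (fun s => expR (c * s)) by apply/cont0_exp/cont0_lin.
have Fc : cont0 F by exact: prim_cont.
have Fi := cont0_locint Fc.
suff kT : k T = k 0.
  apply/eqP; rewrite -subr_eq0; apply/eqP.
  by move: kT; rewrite /k /F !prim0 !mulr0 subrr addr0 => <-; ring.
have [L [L0 LP]] := expR_lipschitz c T.
apply: (@constant_of_increment_le k N (2 * L)) => // a b a0 ab bT.
have fab := @segment_integrable f a b fi a0.
have iab h : locint h -> mu.-integrable `]a, b] (EFin \o h).
  by move=> hi; exact: segment_integrable.
have Nab : 0 <= N b - N a.
  by apply: le_trans (normr_prim_segment fi a0 ab); rewrite normr_ge0.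
have cexp_int h : cont0 h -> mu.-integrable `]a, b] (EFin \o (fun s => c * expR (c * s) * h s)).
  move=> hc; apply: iab; apply: cont0_locint; apply: cont0M => //.
  by apply: cont0M => //; exact: cont0_cst.
have FFac : cont0 (fun s => F s - F a) by apply: cont0D => //; exact: cont0_cst.
(* Regrouped in this way, each integrand contains the increment of one factor over part of []a, b]],
   which makes both integrals of second order. *)
have -> : k b - k a = \int[mu]_(s in `]a, b]) ((expR (c * s) - expR (c * b)) * f s)
    + \int[mu]_(s in `]a, b]) (c * expR (c * s) * (F s - F a)).
  have -> : \int[mu]_(s in `]a, b]) ((expR (c * s) - expR (c * b)) * f s) =
     \int[mu]_(s in `]a, b]) (expR (c * s) * f s) - expR (c * b) * (F b - F a).
    rewrite prim_segment// -RintegralZl// -RintegralB//.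
    - by apply: eq_Rintegral => s _; rewrite mulrBl.
    - by apply: iab; exact: locint_mul.
    - by apply: (iab (fun s => expR (c * b) * f s)); apply: locint_mul => //; exact: cont0_cst.
  have -> : \int[mu]_(s in `]a, b]) (c * expR (c * s) * (F s - F a)) =
     c * (\int[mu]_(s in `]a, b]) (expR (c * s) * F s)) -
     F a * (expR (c * b) - expR (c * a)).
    have -> : expR (c * b) - expR (c * a) =
       \int[mu]_(s in `]a, b]) (c * expR (c * s) * 1).
      rewrite -prim_segment//; last first.
        apply: cont0_locint; apply: cont0M; last exact: cont0_cst.
        by apply: cont0M => //; exact: cont0_cst.
      by rewrite !prim_cexp// ?(le_trans a0)//; ring.
    rewrite -!RintegralZl//; last 2 first.
    - exact: cexp_int (cont0_cst (c := 1)).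
    - by apply: iab; apply: locint_mul.
    rewrite -RintegralB//.
    - by apply: eq_Rintegral => s _; ring.
    - apply: (iab (fun s => c * (expR (c * s) * F s))).
      by apply: locint_mul; [exact: cont0_cst|exact: locint_mul].
    - apply: (iab (fun s => F a * (c * expR (c * s) * 1))).
      apply: cont0_locint; apply: cont0M; first exact: cont0_cst.
      apply: cont0M; last exact: cont0_cst.
      by apply: cont0M => //; exact: cont0_cst.
  rewrite -!prim_segment//; [|exact: locint_mul..].
  by rewrite /k; ring.
apply: le_trans (ler_normD _ _) _.
have -> : 2 * L * (b - a) * (N b - N a) =
  L * (b - a) * (N b - N a) + L * (N b - N a) * (b - a) by ring.
apply: lerD.
  (* First integral: the exponential varies by at most [L * (b - a)], and [|f|] integrates to
     [N b - N a]. *)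
  have efi : mu.-integrable `]a, b] (EFin \o (fun s => (expR (c * s) - expR (c * b)) * f s)).
    by apply: iab; apply: locint_mul => //; apply: cont0D => //; exact: cont0_cst.
  apply: le_trans (le_normr_Rintegral _ efi) _ => //.
  rewrite prim_segment//; last exact: locint_norm.
  rewrite -RintegralZl//; last by apply: iab; exact: locint_norm.
  apply: le_Rintegral => //.
  - exact: integrable_norm efi.
  - apply: (iab (fun s => L * (b - a) * `|f s|)).
    by apply: locint_mul; [exact: cont0_cst|exact: locint_norm].
  - move=> s /=; rewrite in_itv/= => /andP[/ltW as_ sb].
    rewrite normrM ler_wpM2r// distrC.
    have [_ /le_trans] := LP s b (le_trans a0 as_) sb bT; apply.
    by rewrite ler_wpM2l// lerD2l lerN2.
(* Second integral: [F s - F a] is at most [N b - N a] in absolute value, and the segment has length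
   [b - a]. *)
apply: le_trans (le_normr_Rintegral _ (cexp_int _ FFac)) _ => //.
have -> : L * (N b - N a) * (b - a) = \int[mu]_(s in `]a, b]) (L * (N b - N a)).
  have mab : fine (mu `]a, b]%classic) = b - a.
    rewrite lebesgue_measure_itv/= lte_fin; case: ltP => //= ba.
    by apply/esym/eqP; rewrite subr_eq0 eq_le ba ab.
  by rewrite Rintegral_cst// -mab.
apply: le_Rintegral => //.
- exact: integrable_norm (cexp_int _ FFac).
- apply: (iab (fun=> L * (N b - N a))).
  by apply: cont0_locint; exact: cont0_cst.
- move=> s /=; rewrite in_itv/= => /andP[/ltW as_ sb].
  have [cL _] := LP s b (le_trans a0 as_) sb bT.
  rewrite normrM ler_pM//.
  apply: le_trans (normr_prim_segment fi a0 as_) _.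
  rewrite lerD2r -subr_ge0.
  apply: le_trans (normr_prim_segment fi (le_trans a0 as_) sb).
  exact: normr_ge0.
Qed.

(** Integration by parts isolates the only rough term, [prim f t]; the remaining convolution has a
    continuous integrand and is differentiable for [t > 0]. *)
Lemma expconv_prim c f t : locint f -> 0 <= t ->
  expconv c f t = prim f t - c * expconv c (prim f) t.
Proof.
move=> fi t0; rewrite !expconvE//; last exact/cont0_locint/prim_cont.
have e1 : expR (- c * t) * expR (c * t) = 1 by rewrite -expRD mulNr addNr expR0.
by rewrite prim_expM// -[in RHS](mul1r (prim f t)) -e1; ring.
Qed.

Lemma prim_ge0_bounded h : cont0 h -> (forall t, 0 <= t -> 0 <= h t) ->
  (\int[mu]_(s in `[0%R, +oo[) (h s)%:E < +oo)%E ->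
  exists M : R, forall t, prim h t <= M.
Proof.
move=> hc h0 hoo; exists (fine (\int[mu]_(s in `[0%R, +oo[) (h s)%:E)%E) => t.
apply: fine_le.
- exact: integrable_fin_num (cont0_locint hc t).
- by rewrite ge0_fin_numE//; apply: integral_ge0 => s /=; rewrite in_itv/= andbT lee_fin; exact: h0.
- apply: ge0_subset_integral => //.
  + by apply/measurable_EFinP; exact: subspace_continuous_measurable_fun.
  + by move=> s /=; rewrite in_itv/= andbT lee_fin; exact: h0.
  + by move=> s /=; rewrite !in_itv/= => /andP[->].
Qed.

End ExponentialConvolution.

(** * Reduction of the damped equation to the perturbed oscillator *)

Theorem mainTheorem19 (R : realType) (w : R) (p f x : R -> R) :
  0 < w ->
  (forall t, 0 <= t -> derivable p t 1) ->
  {within `[0, +oo[, continuous derive1 p} ->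
  (forall t, 0 <= t -> 0 < p t) ->
  (forall t, 0 <= t -> derive1 p t < 0) ->
  (\int[@lebesgue_measure R]_(s in @halfline R) (p s)%:E = +oo)%E ->
  (\int[@lebesgue_measure R]_(s in @halfline R) ((p s) ^+ 2)%:E < +oo)%E ->
  (forall t, 0 <= t -> (@lebesgue_measure R).-integrable `[0, t] (EFin \o f)) ->
  is_solution p f w x ->
  x 0 = 0 -> derive1 x 0 = 0 ->
  (Afun p t * y2fun w f t) @[t --> +oo] --> 0 ->
  (\int[@lebesgue_measure R]_(s in @halfline R) (Afun p s * `|y2fun w f s|)%:E < +oo)%E ->
  exists c1 c2 : R,
    (Afun p t * x t - (c1 * sin (w * t) + c2 * cos (w * t))) @[t --> +oo] --> 0.
Proof.
move=> w0 dp _ p_gt0 p'_lt0 _ p2oo fint [dx [x'c xE]] _ _ Ay2_cvg Ay2oo.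
have fi : locint f.
  move=> t; have [/fint//|t0] := leP 0 t.
  by rewrite set_itv_ge ?bnd_simp -?ltNge//; exact: integrable_set0.
pose c := w ^+ 2; pose y1 := expconv c f; pose y2 := expconv c y1.
pose A := Afun p; pose F := prim f; pose W := expconv c F.
have Fc : cont0 F by exact: prim_cont.
have y1c : cont0 y1 by exact: expconv_cont.
have y2c : cont0 y2 by exact/expconv_cont/cont0_locint.
have pc : cont0 p by exact: cont0_derivable.
have xc : cont0 x by exact: cont0_derivable.
have Ac : cont0 A.
  apply: cont0_exp; apply: cont0M; first exact: cont0_cst.
  exact/prim_cont/cont0_locint.
have A0 (t : R) : 0 < A t by exact: expR_gt0.
pose x' := derive1 x; pose p' := derive1 p.
(* [D] is [x' - y1] with the common term [F] cancelled; what is left is differentiable for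
   [t > 0]. *)
pose D t := x' 0 - prim (fun s => p s * x' s + c * x s) t + c * W t.
have pxc : cont0 (fun s => p s * x' s + c * x s).
  apply: cont0D; first exact: cont0M.
  by apply: cont0M => //; exact: cont0_cst.
have y1E (t : R) : 0 <= t -> y1 t = F t - c * W t by exact: expconv_prim.
have x'E (t : R) : 0 <= t -> x' t = D t + y1 t.
  move=> t0; rewrite y1E// /D /x' xE// /F /prim.
  rewrite (_ : Rintegral _ _ _ = \int[@lebesgue_measure R]_(s in `[0, t]) f s -
    \int[@lebesgue_measure R]_(s in `[0, t]) (p s * derive1 x s + c * x s)); last first.
    rewrite -RintegralB//; last exact: cont0_locint pxc t.
    by apply: eq_Rintegral => s _; rewrite /c; ring.
  ring.
have dA (t : R) : 0 < t -> is_derive t 1 A (A t * (2^-1 * p t)).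
  move=> t0; exact: is_derive_expcomp (is_derive_scale 2^-1 (prim_derive pc t0)).
have dpE (t : R) : 0 < t -> is_derive t 1 p (p' t).
  by move=> /ltW/dp pt; split => //; rewrite /p' derive1E.
have dy2 (t : R) : 0 < t -> is_derive t 1 y2 (y1 t - c * y2 t) by exact: expconv_derive.
have dW (t : R) : 0 < t -> is_derive t 1 W (y1 t).
  by move=> t0; rewrite y1E ?ltW//; exact: expconv_derive.
have dxE (t : R) : 0 < t -> is_derive t 1 x (D t + y1 t).
  by move=> /ltW t0; rewrite -x'E//; split; [exact: dx|rewrite /x' derive1E].
have dD (t : R) : 0 < t -> is_derive t 1 D (0 - (p t * x' t + c * x t) + c * y1 t).
  move=> t0; apply: is_derive_add; last exact: is_derive_scale (dW _ t0).
  exact: is_derive_sub (is_derive_const _ _) (prim_derive pxc t0).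
pose z t := x t - y2 t; pose dz t := D t + c * y2 t.
have dzE (t : R) : 0 < t -> is_derive t 1 z (dz t).
  move=> t0; apply: (is_derive_eq (is_derive_sub (dxE _ t0) (dy2 _ t0))).
  by rewrite /dz; ring.
pose v t := A t * z t.
(* In the derivative of [dv], [y1] has the coefficient [A t * (2 * c - p t)]. Since
   [y2' = y1 - c * y2], the derivative of [g] contains exactly the same term. *)
pose g t := A t * ((2 * c - p t) * y2 t).
pose dv t := A t * dz t + A t * (2^-1 * p t) * z t.
pose r t := dv t - g t.
pose q t := 2^-1 * p' t + 4^-1 * p t ^+ 2.
pose h t := A t * y2 t * (c ^+ 2 - c - c * p t + 2^-1 * p t ^+ 2 + p' t).
have [T /= [_ AyT]] : \forall t \near +oo, `|A t * y2 t| < 1.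
  move/cvgr0Pnorm_lt : Ay2_cvg => /(_ 1 ltr01); exact.
(* Beyond [T] for the bound on [A * y2], and positive because the derivatives above are available
   only for [t > 0]. *)
pose a := `|T| + 1.
have a0 (t : R) : a <= t -> 0 < t.
  by apply: lt_le_trans; rewrite /a ltr_wpDl.
have Ay1 (t : R) : a <= t -> `|A t * y2 t| <= 1.
  move=> at_; apply/ltW/AyT; apply: lt_le_trans at_.
  by apply: le_lt_trans (ler_norm _) _; rewrite ltrDl.
pose P := p a.
have pP (t : R) : a <= t -> p t <= P.
  move=> at_; rewrite -lerN2.
  apply: (nondecreasing_of_derive (f := fun t => - p t) (a := a)
     (fun t at_ => is_derive_opp (dpE t (a0 _ at_)))) => //.
  by move=> s as_; rewrite oppr_ge0 ltW// p'_lt0// ltW// a0.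
have [M1 M1P] : exists M : R, forall t, prim (fun s => p s ^+ 2) t <= M.
  apply: prim_ge0_bounded => //; first exact: cont0M.
  by move=> t _; exact: sqr_ge0.
have Ayc : cont0 (fun s => A s * `|y2 s|) by apply: cont0M => //; exact: cont0_norm.
have [M2 M2P] : exists M : R, forall t, prim (fun s => A s * `|y2 s|) t <= M.
  apply: prim_ge0_bounded => // t _.
  by rewrite mulr_ge0 ?normr_ge0// ltW.
pose psi t := - p' t + p t ^+ 2 + A t * `|y2 t|.
(* The first term is a primitive of [- p'] and is negative, as [p] is positive; the other two are
   bounded by the integrability assumptions. *)
pose Phi t := - p t + prim (fun s => p s ^+ 2) t + prim (fun s => A s * `|y2 s|) t.
(* A crude sum that dominates [1] and the coefficients in [g] and [h], using [p t <= P] for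
   [t >= a]. *)
pose k := 2 * c + P + c ^+ 2 + c + c * P + P ^+ 2 + 1.
have c0 : 0 < c by rewrite exprn_gt0.
have P0 : 0 < P by rewrite p_gt0// ltW// a0.
have P20 : 0 < P ^+ 2 by rewrite exprn_gt0.
have c20 : 0 < c ^+ 2 by rewrite exprn_gt0.
have cP0 : 0 < c * P by rewrite mulr_gt0.
have pieces (t : R) : a <= t -> [/\ 0 < - p' t, 0 < p t ^+ 2 & 0 <= A t * `|y2 t|].
  move=> at_; have t0 := ltW (a0 _ at_); split; first by rewrite oppr_gt0 p'_lt0.
    by rewrite exprn_gt0// p_gt0.
  by rewrite mulr_ge0 ?normr_ge0// ltW.
have pb (t : R) : a <= t -> [/\ 0 < p t, p t <= P & p t ^+ 2 <= P ^+ 2].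
  move=> at_; have t0 := p_gt0 t (ltW (a0 _ at_)); split => //; first exact: pP.
  by rewrite ler_pXn2r ?pP// nnegrE ltW.
have Ayn (t : R) : `|A t * y2 t| = A t * `|y2 t| by rewrite normrM gtr0_norm.
have k0 : 0 < k by rewrite /k; lra.
have [c1 [c2 vlim]] : exists c1 c2 : R,
    (v t - (c1 * sin (w * t) + c2 * cos (w * t))) @[t --> +oo] --> 0.
  apply: (@oscillator_asymptotics _ w k (M1 + M2) a v r g q h Phi psi) => //.
  - move=> t at_; have t0 := a0 _ at_.
    apply: (is_derive_eq (is_derive_mul (dA _ t0) (dzE _ t0))).
    by rewrite /r /dv; ring.
  - move=> t at_; have t0 := a0 _ at_.
    have ddz := is_derive_add (dD _ t0) (is_derive_scale c (dy2 _ t0)).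
    have dp2 := is_derive_mul (dA _ t0) (is_derive_scale 2^-1 (dpE _ t0)).
    have dg := is_derive_mul (dA _ t0) (is_derive_mul
      (is_derive_sub (is_derive_const t (2 * c)) (dpE _ t0)) (dy2 _ t0)).
    apply: (is_derive_eq (is_derive_sub (is_derive_add
       (is_derive_mul (dA _ t0) ddz) (is_derive_mul dp2 (dzE _ t0))) dg)).
    rewrite x'E ?ltW// /q /v /h /dz /z -/c; lra.
  - move=> t at_; have t0 := a0 _ at_.
    apply: is_derive_add; last exact: prim_derive Ayc t0.
    apply: is_derive_add; first exact: is_derive_opp (dpE _ t0).
    by apply: prim_derive t0; exact: cont0M.
  - move=> t at_; rewrite /Phi.
    have := M1P t; have := M2P t; have [+ _ _] := pb _ at_; lra.
  - move=> t at_; have [e1 e2 e3] := pieces _ at_; have [b1 b2 b3] := pb _ at_.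
    rewrite /g mulrCA normrM Ayn.
    have : `|2 * c - p t| <= k by rewrite ler_norml /k; apply/andP; split; lra.
    move=> le1; apply: (@le_trans _ _ (k * (A t * `|y2 t|))); first exact: ler_wpM2r.
    by rewrite ler_pM2l// /psi; lra.
  - move=> t at_; have [e1 e2 e3] := pieces _ at_; have [b1 b2 b3] := pb _ at_.
    (* [p'] and [p ^+ 2] enter [q] with weights below [1], hence [psi] itself suffices. *)
    have : `|q t| <= psi t by rewrite ler_norml /q /psi; apply/andP; split; lra.
    move=> le1; apply: le_trans le1 _; rewrite ler_peMl//; first by rewrite /psi; lra.
    by rewrite /k; lra.
  - move=> t at_; have [e1 e2 e3] := pieces _ at_; have [b1 b2 b3] := pb _ at_.
    have cp : c * p t <= c * P by rewrite ler_pM2l.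
    have cp' : 0 < c * p t by rewrite mulr_gt0.
    (* The [p'] term is split off: its factor [A * y2] is bounded by [1], leaving the integrable
       [- p']. The other coefficient is bounded by [k]. *)
    rewrite /h mulrDr; apply: le_trans (ler_normD _ _) _.
    have h1 : `|A t * y2 t * (c ^+ 2 - c - c * p t + 2^-1 * p t ^+ 2)| <=
        k * (A t * `|y2 t|).
      rewrite normrM Ayn mulrC ler_wpM2r// ler_norml /k; apply/andP; split; lra.
    have h2 : `|A t * y2 t * p' t| <= k * - p' t.
      rewrite normrM (ltr0_norm (p'_lt0 _ (ltW (a0 _ at_)))) ler_wpM2r ?(ltW e1)//.
      by apply: le_trans (Ay1 _ at_) _; rewrite /k; lra.
    have h3 : 0 <= k * p t ^+ 2 by rewrite mulr_ge0// ltW.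
    have -> : k * psi t = k * - p' t + k * p t ^+ 2 + k * (A t * `|y2 t|).
      by rewrite /psi; ring.
    by lra.
exists c1, c2.
(* [A * x = v + A * y2], and the last term tends to [0] by assumption. *)
rewrite (_ : (fun t => _) = fun t =>
  (v t - (c1 * sin (w * t) + c2 * cos (w * t))) + A t * y2 t).
  by rewrite -(addr0 0); apply: cvgD.
by apply/funext => t; rewrite /v /z /A; ring.
Qed.
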